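(* Let $l,l'\ge 1$ be natural numbers, let $r_1,\dots,r_l\in\mathbb{C}$ and let $s_1,\dots,s_{l'}\in\mathbb{C}\setminus\{0\}$. Let $\mathbb{B}=\mathbb{B}(r_1,\dots,r_l;s_1,\dots,s_{l'})$, acting as a bounded linear operator on $c_0$. Then the point spectrum of $\mathbb{B}$ is empty: $\sigma_p(\mathbb{B},c_0)=\emptyset$.
   Context: $c_0$ is the Banach space of complex sequences $x=(x_k)_{k\ge 0}$ converging to $0$, with the supremum norm. For an integer $a$ and $n\in\mathbb{N}$, $a\,(\mathrm{mod}\ n)$ denotes the remainder in $\{0,\dots,n-1\}$ of $a$ modulo $n$. The matrix $\mathbb{B}(r_1,\dots,r_l;s_1,\dots,s_{l'})=(b_{ij})_{i,j\ge 0}$ is the infinite lower triangular matrix with $b_{ij}=r_{j(\mathrm{mod}\ l)+1}$ if $i=j$, $b_{ij}=s_{j(\mathrm{mod}\ l')+1}$ if $i=j+1$, and $b_{ij}=0$ otherwise; it acts on $x=(x_k)_{k\ge0}$ by $(\mathbb{B}x)_k=s_{(k-1)(\mathrm{mod}\ l')+1}x_{k-1}+r_{k(\mathrm{mod}\ l)+1}x_k$, with $x_{-1}=0$. The point spectrum $\sigma_p(T,X)$ is the set of $\lambda\in\mathbb{C}$ for which $(T-\lambda I)^{-1}$ does not exist, i.e. $T-\lambda I$ is not injective on $X$ (the eigenvalues of $T$). *)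

(* Defs.v *)
From HB Require Import structures.
From mathcomp Require Import all_boot all_order all_algebra complex.
From mathcomp Require Import all_classical all_reals all_analysis.

Set Implicit Arguments.
Unset Strict Implicit.
Unset Printing Implicit Defensive.

Import Order.TTheory GRing.Theory Num.Theory numFieldNormedType.Exports.

Local Open Scope classical_set_scope.
Local Open Scope ring_scope.
Local Open Scope complex_scope.

Section ComplexNorm.
Variable R : realType.
Implicit Types z : R[i].

Lemma normCE z : `|z| = (complex.Re `|z|)%:C.
Proof. by rewrite RRe_real// normr_real. Qed.

Lemma Re_norm_ge0 z : 0 <= complex.Re `|z|.
Proof. by rewrite -ler0c -normCE. Qed.

Lemma posC (e : R[i]) : 0 < e -> exists2 d : R, 0 < d & e = d%:C.
Proof.
case: e => a b; rewrite ltcE/= => /andP[/eqP -> a0]; by exists a.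
Qed.

Lemma norm_real_complex (a : R) : `|a%:C : R[i]| = `|a|%:C.
Proof. by rewrite normc_def/= expr0n/= addr0 sqrtr_sqr. Qed.

Lemma Re_norm_le z : `|complex.Re z|%:C <= `|z|.
Proof. exact: normc_ge_Re. Qed.

Lemma Im_norm_le z : `|complex.Im z|%:C <= `|z|.
Proof.
rewrite normc_def lecR -sqrtr_sqr ler_wsqrtr// lerDr sqr_ge0//.
Qed.

Lemma norm_le_ReIm z : `|z| <= (`|complex.Re z| + `|complex.Im z|)%:C.
Proof.
rewrite {1}[z]complexE rmorphD/= (le_trans (ler_normD _ _))//.
by rewrite normrM !norm_real_complex normc_def/= !expr0n/= expr1n add0r sqrtr1 mul1r.
Qed.

(* This cannot be declared as an instance: the structure Complete already has
   one for the regular algebra of a realType. *)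
Lemma complex_complete (F : set_system R[i]^o) :
  ProperFilter F -> cauchy F -> cvg F.
Proof.
move=> FF /cauchyP Fc.
have cauchy_part (p : R[i] -> R) : {morph p : x y / x - y} ->
    (forall z, `|p z|%:C <= `|z|) -> cvg (p @ F).
  move=> pB ple.
  apply: R_complete; apply: cauchy_exP => e e0.
  have eC : 0 < e%:C :> R[i] by rewrite ltcR.
  have [z Fz] := Fc _ eC.
  exists (p z); rewrite -[_ (ball _ _)]/(F (p @^-1` ball (p z) e)).
  apply: filterS Fz => w.
  rewrite -!ball_normE/= => zw.
  by rewrite -pB -ltcR (le_lt_trans (ple _)).
have /cvg_ex[a Fa] : cvg (@complex.Re R @ F).
  by apply: cauchy_part; [move=> [? ?] [? ?] | exact: Re_norm_le].
have /cvg_ex[b Fb] : cvg (@complex.Im R @ F).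
  by apply: cauchy_part; [move=> [? ?] [? ?] | exact: Im_norm_le].
apply/cvg_ex; exists (a +i* b : R[i]^o).
apply/cvgrPdist_lt => _ /posC[e e0 ->].
have e2 : 0 < e / 2 by rewrite divr_gt0.
move/cvgrPdist_lt : Fa => /(_ _ e2) Fa.
move/cvgrPdist_lt : Fb => /(_ _ e2) Fb.
near=> z.
apply: le_lt_trans (norm_le_ReIm _) _.
rewrite ltcR [e]splitr.
have -> : complex.Re ((a +i* b) - z) = a - complex.Re z by case: (z).
have -> : complex.Im ((a +i* b) - z) = b - complex.Im z by case: (z).
by apply: ltrD; near: z.
Unshelve. all: by end_near. Qed.

End ComplexNorm.

Section C0.
Variable R : realType.

Definition c0_pred : {pred nat -> R[i]^o} :=
  fun x => `[< x @ \oo --> (0 : R[i]^o) >].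

Lemma c0_predP (x : nat -> R[i]^o) :
  reflect (x @ \oo --> (0 : R[i]^o)) (x \in c0_pred).
Proof. exact: asboolP. Qed.

Lemma c0_submod_closed : submod_closed c0_pred.
Proof.
split; first by apply/c0_predP; exact: cvg_cst.
move=> a x y /c0_predP x0 /c0_predP y0; apply/c0_predP.
have : (a *: x) + y @ \oo --> a *: (0 : R[i]^o) + (0 : R[i]^o).
  by apply: (@cvgD _ R[i]^o _ _ _ (a *: x) y _ _ _ y0); exact: cvgZl_tmp.
by rewrite scaler0 addr0.
Qed.

HB.instance Definition _ :=
  GRing.isSubmodClosed.Build R[i] (nat -> R[i]^o) c0_pred c0_submod_closed.

Record c0 : Type := MkC0 { c0_val :> nat -> R[i]^o ; _ : c0_val \in c0_pred }.

HB.instance Definition _ := [isSub for c0_val].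
HB.instance Definition _ := [Choice of c0 by <:].
HB.instance Definition _ := [SubChoice_isSubLmodule of c0 by <:].

Implicit Types x y : c0.

Lemma c0_cvg x : x @ \oo --> (0 : R[i]^o).
Proof. by case: x => x /= /c0_predP. Qed.

Lemma c0D x y k : (x + y) k = x k + y k. Proof. by []. Qed.
Lemma c0B x y k : (x - y) k = x k - y k. Proof. by []. Qed.
Lemma c0Z (a : R[i]) x k : (a *: x) k = a * x k. Proof. by []. Qed.

Lemma c0_ext x y : (forall k, x k = y k) -> x = y.
Proof. by move=> xy; apply/val_inj/funext. Qed.

Definition c0_sup x : R := sup (range (fun k => complex.Re `|x k|)).

(* Norms take values in the scalar field R[i] in the library, whence the
   injection of the real supremum into R[i]. *)
Definition c0_norm x : R[i] := (c0_sup x)%:C.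

Lemma c0_has_sup x : has_sup (range (fun k => complex.Re `|x k|)).
Proof.
split; first by exists (complex.Re `|x 0%N|), 0%N.
have [M [Mr xM]] := cvg_seq_bounded (cvgP _ (c0_cvg x)).
exists (complex.Re (M + 1)) => _ [k _ <-].
have /= := xM (M + 1) _ k I.
rewrite ltrDl ltr01 => /(_ isT).
by rewrite lecE => /andP[].
Qed.

Lemma c0_norm_ub x k : `|x k| <= c0_norm x.
Proof.
rewrite normCE lecR; apply: sup_upper_bound; first exact: c0_has_sup.
by exists k.
Qed.

Lemma c0_norm_le x (e : R) : (forall k, `|x k| <= e%:C) -> c0_norm x <= e%:C.
Proof.
move=> xe; rewrite lecR; apply: ge_sup; first by case: (c0_has_sup x).
by move=> _ [k _ <-]; rewrite -lecR -normCE.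
Qed.

Lemma c0_ler_normD x y : c0_norm (x + y) <= c0_norm x + c0_norm y.
Proof.
rewrite -rmorphD; apply: c0_norm_le => k.
rewrite rmorphD c0D (le_trans (ler_normD _ _))// lerD// ?c0_norm_ub//.
Qed.

Lemma c0_normZ_le (a : R[i]) x : c0_norm (a *: x) <= `|a| * c0_norm x.
Proof.
have an := normCE a.
rewrite an -rmorphM; apply: c0_norm_le => k.
by rewrite c0Z normrM rmorphM/= -an ler_wpM2l// c0_norm_ub.
Qed.

Lemma c0_normZ (a : R[i]) x : c0_norm (a *: x) = `|a| * c0_norm x.
Proof.
apply/eqP; rewrite eq_le c0_normZ_le /=.
have [->|a0] := eqVneq a 0.
  rewrite normr0 mul0r; exact: le_trans (normr_ge0 _) (c0_norm_ub _ 0).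
rewrite mulrC -ler_pdivlMr ?normr_gt0// mulrC -normfV.
apply: le_trans (c0_normZ_le _ _).
by rewrite scalerA mulVf// scale1r.
Qed.

Lemma c0_norm_eq0 x : c0_norm x = 0 -> x = 0.
Proof.
move=> x0; apply: c0_ext => k; apply/eqP; rewrite -normr_eq0 eq_le normr_ge0.
by rewrite andbT -x0 c0_norm_ub.
Qed.

HB.instance Definition _ := Lmodule_isNormed.Build R[i] c0
  c0_ler_normD c0_normZ c0_norm_eq0.

Lemma c0_normE x : `|x| = (sup (range (fun k => complex.Re `|x k|)))%:C.
Proof. by []. Qed.

Lemma c0_complete (F : set_system c0) : ProperFilter F -> cauchy F -> cvg F.
Proof.
move=> FF /cauchyP Fc.
pose ev k (x : c0) : R[i]^o := x k.
have evc k : cvg (ev k @ F).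
  apply: complex_complete; apply: cauchy_exP => e e0.
  have [p Fp] := Fc _ e0; exists (p k); rewrite -[_ (ball _ _)]/(F (ev k @^-1` ball (p k : R[i]^o) e)).
  apply: filterS Fp => x.
  rewrite -!ball_normE/= => px.
  by rewrite (le_lt_trans _ px)// -c0B c0_norm_ub.
pose y k : R[i]^o := lim (ev k @ F).
have yle (p : c0) (e : R) : F (ball p e%:C) -> forall k, `|p k - y k| <= e%:C.
  move=> Fp k; rewrite normCE lecR; apply/ler_addgt0Pr => d d0.
  rewrite -lecR -normCE rmorphD.
  have dC : 0 < d%:C :> R[i] by rewrite ltcR.
  have /cvgrPdist_lt/(_ _ dC) Fd := evc k.
  have [x [px yx]] := filter_ex (filterI Fp Fd).
  have -> : p k - y k = (p k - x k) - (y k - x k).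
    by rewrite opprB addrA subrK.
  apply: le_trans (ler_normB _ _) _; apply: lerD; last exact: ltW.
  move: px; rewrite -ball_normE/= => /ltW; apply: le_trans.
  by rewrite -c0B c0_norm_ub.
have y0 : y \in c0_pred.
  apply/c0_predP/cvgrPdist_lt => _ /posC[e e0 ->].
  have e2 : 0 < (e / 2)%:C :> R[i] by rewrite ltcR divr_gt0.
  have [p Fp] := Fc _ e2.
  have /cvgrPdist_lt/(_ _ e2) pe := c0_cvg p.
  near=> k.
  have -> : 0 - y k = (p k - y k) + (0 - p k) by rewrite !sub0r addrAC subrr sub0r.
  rewrite [e]splitr rmorphD (le_lt_trans (ler_normD _ _))// ler_ltD ?yle//.
  by near: k.
apply/cvg_ex; exists (MkC0 y0); apply/cvgrPdist_le => _ /posC[e e0 ->].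
have e2 : 0 < (e / 2)%:C :> R[i] by rewrite ltcR divr_gt0.
have [p Fp] := Fc _ e2.
apply: filterS (Fp) => x; rewrite -ball_normE/= => px.
apply: c0_norm_le => k; rewrite c0B/=.
have -> : y k - x k = (p k - x k) - (p k - y k).
  by rewrite opprB [RHS]addrC addrA subrK.
rewrite [e]splitr rmorphD (le_trans (ler_normB _ _))// lerD ?yle//.
by rewrite -c0B (le_trans (c0_norm_ub _ _))// ltW.
Unshelve. all: by end_near. Qed.

HB.instance Definition _ := Uniform_isComplete.Build c0 c0_complete.

End C0.

Section Band.
Variables (R : realType) (l l' : nat).
Variables (r : l.-tuple R[i]) (s : l'.-tuple R[i]).

(* Tuples are indexed from 0, so r`_(j %% l) is r_{j (mod l) + 1}. *)
Definition band_matrix (i j : nat) : R[i] :=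
  if i == j then r`_(j %% l)
  else if i == j.+1 then s`_(j %% l')
  else 0.

Definition band_seq (x : nat -> R[i]^o) : nat -> R[i]^o := fun k =>
  (if k is k'.+1 then s`_(k' %% l') * x k' else 0) + r`_(k %% l) * x k.

(* Row k of the matrix is supported on columns below k.+1, so the series
   defining the action of the matrix is this finite sum. *)
Lemma band_seqE (x : nat -> R[i]^o) (k n : nat) : (k < n)%N ->
  band_seq x k = \sum_(0 <= j < n) band_matrix k j * x j.
Proof.
move=> kn; rewrite (@big_cat_nat _ _ _ k.+1)//=.
have -> : \sum_(k.+1 <= j < n) band_matrix k j * x j = 0.
  rewrite big_nat big1// => j /andP[kj _].
  by rewrite /band_matrix ltn_eqF// ltn_eqF ?mul0r// ltnW.
rewrite addr0 big_nat_recr//= /band_seq {2}/band_matrix eqxx; congr (_ + _).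
case: k kn => [|k] kn; first by rewrite big_geq.
rewrite big_nat_recr//=.
have -> : \sum_(0 <= j < k) band_matrix k.+1 j * x j = 0.
  rewrite big_nat big1// => j /andP[_ jk].
  by rewrite /band_matrix eqSS !gtn_eqF ?mul0r// ltnW.
by rewrite add0r /band_matrix eqxx gtn_eqF.
Qed.

Definition band_bound : R[i] := \sum_(z <- s) `|z| + \sum_(z <- r) `|z|.

Lemma nth_le_sum_norm (t : seq R[i]) (i : nat) :
  `|t`_i| <= \sum_(z <- t) `|z|.
Proof.
have [it|ti] := ltnP i (size t).
  rewrite (big_nth 0) big_mkord (bigD1 (Ordinal it))//= lerDl.
  by apply: sumr_ge0.
by rewrite nth_default// normr0 sumr_ge0.
Qed.

Lemma band_seq_le (x : nat -> R[i]^o) (e : R[i]) (k : nat) : 0 <= e ->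
  `|x k.-1| <= e -> `|x k| <= e -> `|band_seq x k| <= band_bound * e.
Proof.
move=> e0 x1 xk; rewrite /band_bound mulrDl /band_seq.
apply: le_trans (ler_normD _ _) _; apply: lerD; last first.
  by rewrite normrM ler_pM// nth_le_sum_norm.
case: k x1 xk => [|k] x1 xk; first by rewrite normr0 mulr_ge0// sumr_ge0.
by rewrite normrM ler_pM// nth_le_sum_norm.
Qed.

Lemma band_bound_ge0 : 0 <= band_bound.
Proof. by rewrite addr_ge0// sumr_ge0. Qed.

Lemma band_seq_c0 (x : c0 R) : band_seq x \in @c0_pred R.
Proof.
apply/c0_predP/cvgrPdist_lt => e e0.
pose d := e / (band_bound + 1).
have M0 : 0 < band_bound + 1 by rewrite ltr_wpDl// band_bound_ge0.
have d0 : 0 < d by rewrite divr_gt0.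
have /cvgrPdist_lt/(_ _ d0) [N _ xd] := c0_cvg x.
exists N.+1 => // k /= Nk.
have xle j : (N <= j)%N -> `|x j| <= d.
  by move=> /xd /=; rewrite sub0r normrN => /ltW.
rewrite sub0r normrN.
apply: (@le_lt_trans _ _ (band_bound * d)).
  apply: band_seq_le; first exact: ltW.
    by apply: xle; case: k Nk.
  by apply: xle; apply: ltnW.
have -> : e = (band_bound + 1) * d by rewrite mulrC divfK// gt_eqF.
by rewrite ltr_pM2r// ltrDl.
Qed.

Definition band (x : c0 R) : c0 R := MkC0 (band_seq_c0 x).

Lemma band_is_linear : linear band.
Proof.
move=> a x y; apply: c0_ext => k.
change (band_seq (a *: x + y) k = a * band_seq x k + band_seq y k).
have xyE j : (a *: x + y) j = a * x j + y j by [].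
rewrite /band_seq; case: k => [|k]; rewrite !xyE !mulrDr !(mulrCA _ a).
  by rewrite mulr0 !add0r.
by rewrite addrACA.
Qed.

HB.instance Definition _ :=
  GRing.isLinear.Build R[i] (c0 R) (c0 R) *:%R band band_is_linear.

Lemma band_norm_le (x : c0 R) : `|band x| <= band_bound * `|x|.
Proof.
have bE : band_bound = (complex.Re band_bound)%:C.
  by rewrite RRe_real// ger0_real// band_bound_ge0.
rewrite bE c0_normE -rmorphM; apply: c0_norm_le => k.
rewrite rmorphM/= -bE; apply: band_seq_le; last exact: c0_norm_ub.
  exact: le_trans (normr_ge0 _) (c0_norm_ub x 0).
exact: c0_norm_ub.
Qed.

Lemma band_continuous : continuous band.
Proof.
apply: bounded_linear_continuous; apply/linear_boundedP.
exists band_bound; split; first by rewrite ger0_real// band_bound_ge0.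
move=> M bM x; apply: le_trans (band_norm_le x) _.
by rewrite ler_wpM2r// ltW.
Qed.

End Band.

Definition point_spectrum (K : numFieldType) (X : normedModType K)
    (T : {linear X -> X}) : set K :=
  [set lambda | ~ injective (fun x => T x - lambda *: x)].

(* Main.v *)
(* If [B x = lambda x] and [m] is the least index with [x m != 0], then row [m]
   gives [lambda = r_m].  By periodicity [lambda] is also the diagonal entry of
   row [m + l], which therefore reads [s_(m+l-1) x_(m+l-1) = 0].  As all [s_j]
   are nonzero, the rows above propagate this zero back to [x m]. *)
Require Import Defs.
From mathcomp Require Import all_boot all_order all_algebra complex.
From mathcomp Require Import all_classical all_reals all_analysis.

Set Implicit Arguments.
Unset Strict Implicit.
Unset Printing Implicit Defensive.

Import Order.TTheory GRing.Theory Num.Theory numFieldNormedType.Exports.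

Local Open Scope classical_set_scope.
Local Open Scope ring_scope.
Local Open Scope complex_scope.

Section BandEigensequence.
Variables (R : realType) (l l' : nat).
Variables (r : l.-tuple R[i]) (s : l'.-tuple R[i]).
Hypotheses (l_gt0 : (0 < l)%N) (s_neq0 : forall k, s`_(k %% l') != 0).
Variables (lambda : R[i]) (x : nat -> R[i]^o).
Hypothesis band_x : forall k, band_seq r s x k = lambda * x k.

(** This is row [k.+1] of [band_x] with its diagonal term moved to the right. *)
Lemma band_eigenseq_row k :
  s`_(k %% l') * x k = (lambda - r`_(k.+1 %% l)) * x k.+1.
Proof. by rewrite mulrBl -band_x /band_seq /= addrK. Qed.

Lemma band_eigenseq_backward m n : x (m + n)%N = 0 -> x m = 0.
Proof.
elim: n => [|n IHn]; first by rewrite addn0.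
rewrite addnS => xS; apply: IHn; apply/eqP.
have /eqP := band_eigenseq_row (m + n).
by rewrite xS mulr0 mulf_eq0 (negPf (s_neq0 _)).
Qed.

Lemma band_eigenseq_eq0 k : x k = 0.
Proof.
elim/ltn_ind: k => m x_lt_m; apply/eqP/negPn/negP => xm_neq0.
have lambdaE : lambda = r`_(m %% l).
  apply: (mulIf xm_neq0); rewrite -band_x /band_seq.
  (* Row 0 has no subdiagonal term; in later rows minimality kills it. *)
  case: m x_lt_m {xm_neq0} => [|m] x_lt_m; first by rewrite add0r.
  by rewrite [x m]x_lt_m// mulr0 add0r.
(* The offset [l.-1] makes the next row [m + l], where the factor [lambda - r] vanishes. *)
case/eqP: xm_neq0; apply: (@band_eigenseq_backward m l.-1); apply/eqP.
have /eqP := band_eigenseq_row (m + l.-1).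
rewrite -addnS prednK// modnDr -lambdaE subrr mul0r mulf_eq0.
by rewrite (negPf (s_neq0 _)).
Qed.

End BandEigensequence.

Theorem theorem3p4 (R : realType) (l l' : nat) (hl : (1 <= l)%N)
    (hl' : (1 <= l')%N) (r : l.-tuple R[i]) (s : l'.-tuple R[i])
    (hs : forall i : 'I_l', tnth s i != 0) :
  point_spectrum (band r s : {linear c0 R -> c0 R}) = set0.
Proof.
(* Membership is a negated injectivity, so injectivity is left to prove. *)
rewrite -subset0 => lambda; apply=> x y Txy.
have s_neq0 k : s`_(k %% l') != 0.
  by have := hs (Ordinal (ltn_pmod k hl')); rewrite (tnth_nth 0).
(* By linearity, a collision of [x] and [y] makes [x - y] solve the eigenvalue equation. *)
have band_xy : band r s (x - y) = lambda *: (x - y).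
  apply/eqP; rewrite -subr_eq0 linearB scalerBr opprD addrACA -opprD.
  by rewrite [_ - _ *: x]Txy subrr.
apply/eqP; rewrite -subr_eq0; apply/eqP/c0_ext => k.
apply: (@band_eigenseq_eq0 _ _ _ r s hl s_neq0 lambda) => j.
by rewrite -c0Z -band_xy.
Qed.
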